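(* For every Catalan state $C$, the coefficients of the Laurent polynomial $C(A)$ are non-negative integers.
   Context: **Catalan states.** For integers $m,n\ge 0$, consider a rectangle with points $x_1,\dots,x_n$ on its top side and $x'_1,\dots,x'_n$ on its bottom side (left to right), and $y_1,\dots,y_m$ on its left side and $y'_1,\dots,y'_m$ on its right side (top to bottom). A Catalan state is a family of pairwise disjoint arcs embedded in the rectangle joining these $2(m+n)$ points in pairs, up to isotopy fixing the boundary points (equivalently, a noncrossing perfect matching of the boundary points). $\mathrm{Cat}(m,n)$ is the set of all Catalan states for given $m,n$. **Coefficients.** A Kauffman state $s\in\mathcal{K}(m,n)$ of the $m\times n$-lattice crossing $L(m,n)$ is an assignment of $\pm1$ to the $mn$ crossings of the grid formed by $m$ horizontal segments (joining $y_i$ to $y'_i$) and $n$ vertical segments (joining $x_j$ to $x'_j$). $D_s$ is obtained by smoothing every crossing: a crossing marked $+1$ is replaced by two disjoint arcs joining its top end to its right end and its left end to its bottom end; one marked $-1$ by arcs joining top to left and right to bottom. $|D_s|$ is the number of closed components of $D_s$, and $C_s\in\mathrm{Cat}(m,n)$ is $D_s$ with its closed components removed. With $p(s),n(s)$ the numbers of $+1$'s and $-1$'s of $s$, for $C\in\mathrm{Cat}(m,n)$ put $$C(A)=\sum_{s\in\mathcal{K}(m,n),\ C_s=C}A^{p(s)-n(s)}(-A^2-A^{-2})^{|D_s|}.$$ *)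

(* Defs.v *)
From HB Require Import structures.
From mathcomp Require Import all_boot all_order all_algebra.
From mathcomp Require Import finmap.
From mathcomp.multinomials Require Export monalg.

Set Implicit Arguments.
Unset Strict Implicit.
Unset Printing Implicit Defensive.

Import GRing.Theory.

Local Open Scope ring_scope.

(* Laurent polynomials in A over int: finitely supported g : int -> int, with
   g@_k the coefficient of A^k. The ring structure that monalg puts on
   {malg R[K]} is not available here, because it requires a monoid K in which
   only the identity is invertible; hence the convolution product below. *)

Definition laurent : Type := {malg int[int]}.
HB.instance Definition _ := GRing.Zmodule.on laurent.

(* The monomial A^k. *)
Definition Apow (k : int) : laurent := << 1%R *g k >>.

Definition laurent_mul (f g : laurent) : laurent :=
  \sum_(i <- msupp f) \sum_(j <- msupp g) << (f@_i * g@_j)%R *g (i + j)%R >>.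

Section LaurentRing.
Implicit Types f g h : laurent.

Let U (c k : int) : laurent := << c *g k >>.

Lemma laurent_mul_wide (d1 d2 : {fset int}) f g :
    (msupp f `<=` d1)%fset -> (msupp g `<=` d2)%fset ->
  laurent_mul f g = \sum_(i <- d1) \sum_(j <- d2) U (f@_i * g@_j) (i + j).
Proof.
move=> le1 le2; rewrite /laurent_mul (big_fset_incl _ le1) /=.
  apply: eq_bigr => i _; rewrite (big_fset_incl _ le2) //= => j _ jNg.
  by rewrite (mcoeff_outdom jNg) mulr0 monalgU0.
move=> i _ iNf; apply: big1_seq => j _.
by rewrite (mcoeff_outdom iNf) mul0r monalgU0.
Qed.

Lemma laurent_mulC : commutative laurent_mul.
Proof.
move=> f g; rewrite /laurent_mul exchange_big; apply: eq_bigr => i _.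
by apply: eq_bigr => j _; rewrite mulrC addrC.
Qed.

Lemma laurent_mulDl : left_distributive laurent_mul +%R.
Proof.
move=> f g h; set d := (msupp f `|` msupp g)%fset.
rewrite (@laurent_mul_wide d (msupp h) (f + g)) ?msuppD_le //.
rewrite (@laurent_mul_wide d (msupp h) f) ?fsubsetUl //.
rewrite (@laurent_mul_wide d (msupp h) g) ?fsubsetUr //.
rewrite -big_split; apply: eq_bigr => i _ /=.
rewrite -big_split; apply: eq_bigr => j _ /=.
by rewrite mcoeffD mulrDl /U monalgUD.
Qed.

Lemma laurent_mulDr : right_distributive laurent_mul +%R.
Proof.
by move=> f g h; rewrite laurent_mulC laurent_mulDl !(laurent_mulC f).
Qed.

Lemma laurent_mul0 : left_zero (0 : laurent) laurent_mul.
Proof. by move=> f; rewrite /laurent_mul msupp0 big_seq_fset0. Qed.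

Lemma laurent_mulr0 : right_zero (0 : laurent) laurent_mul.
Proof. by move=> f; rewrite laurent_mulC laurent_mul0. Qed.

Lemma laurent_mulU c1 c2 k1 k2 :
  laurent_mul (U c1 k1) (U c2 k2) = U (c1 * c2) (k1 + k2).
Proof.
by rewrite (laurent_mul_wide msuppU_le msuppU_le) !big_seq_fset1 !mcoeffUU.
Qed.

Lemma laurentE f : f = \sum_(i <- msupp f) U f@_i i.
Proof. exact: monalgE. Qed.

Lemma laurent_mul_suml (r : seq int) (F : int -> laurent) g :
  laurent_mul (\sum_(i <- r) F i) g = \sum_(i <- r) laurent_mul (F i) g.
Proof.
exact: (big_morph (laurent_mul^~ g) (fun a b => laurent_mulDl a b g)
  (laurent_mul0 g)).
Qed.

Lemma laurent_mul_sumr (r : seq int) (F : int -> laurent) g :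
  laurent_mul g (\sum_(i <- r) F i) = \sum_(i <- r) laurent_mul g (F i).
Proof.
rewrite laurent_mulC laurent_mul_suml; apply: eq_bigr => i _.
exact: laurent_mulC.
Qed.

Lemma laurent_mulA : associative laurent_mul.
Proof.
(* Abstracting the product keeps rewriting from unfolding it to a sum. *)
move: laurent_mul laurent_mul_suml laurent_mul_sumr laurent_mulU.
move=> mul mul_suml mul_sumr mulU f g h.
rewrite [f]laurentE !mul_suml; apply: eq_bigr => i _.
rewrite [g]laurentE mul_suml !mul_sumr mul_suml; apply: eq_bigr => j _.
rewrite [h]laurentE !mul_sumr; apply: eq_bigr => k _.
by rewrite !mulU mulrA addrA.
Qed.

Lemma laurent_mul1 : left_id (Apow 0) laurent_mul.
Proof.
move=> f; rewrite /laurent_mul /Apow msuppU oner_eq0 big_seq_fset1.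
rewrite [RHS]laurentE; apply: eq_bigr => i _.
by rewrite mcoeffUU mul1r add0r.
Qed.

Lemma laurent_1_neq0 : Apow 0 != 0 :> laurent.
Proof.
by apply/eqP => /(congr1 (mcoeff 0)); rewrite mcoeff0 mcoeffUU => /eqP.
Qed.

HB.instance Definition _ := GRing.Zmodule_isComNzRing.Build laurent
  laurent_mulA laurent_mulC laurent_mul1 laurent_mulDl laurent_1_neq0.

Lemma Apow0 : Apow 0 = 1 :> laurent.
Proof. by []. Qed.

Lemma ApowD i j : Apow (i + j) = Apow i * Apow j.
Proof. by rewrite /Apow -[RHS]/(laurent_mul _ _) laurent_mulU mul1r. Qed.

End LaurentRing.

(* Top j, Bottom j are x_j, x'_j and Left i, Right i are y_i, y'_i, with
   indices starting from 0; 'I_n is ordered from left to right and 'I_m from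
   top to bottom. *)
Inductive boundary (m n : nat) : Type :=
  | Top of 'I_n | Bottom of 'I_n | Left of 'I_m | Right of 'I_m.

Arguments Top {m n} _.
Arguments Bottom {m n} _.
Arguments Left {m n} _.
Arguments Right {m n} _.

(* Hor i k is the k-th piece, from the left, of the i-th horizontal segment cut
   at its n crossings; Ver k j is the k-th piece, from the top, of the j-th
   vertical segment cut at its m crossings. *)
Inductive piece (m n : nat) : Type :=
  | Hor of 'I_m & 'I_n.+1 | Ver of 'I_m.+1 & 'I_n.

Arguments Hor {m n} _ _.
Arguments Ver {m n} _ _.

Section FiniteTypes.
Variables m n : nat.

Definition boundary_code (p : boundary m n) :=
  match p with
  | Top j => inl (inl j) | Bottom j => inl (inr j)
  | Left i => inr (inl i) | Right i => inr (inr i)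
  end.
Definition boundary_decode (u : ('I_n + 'I_n) + ('I_m + 'I_m)) :=
  match u with
  | inl (inl j) => Top j | inl (inr j) => Bottom j
  | inr (inl i) => Left i | inr (inr i) => Right i
  end.
Lemma boundary_codeK : cancel boundary_code boundary_decode.
Proof. by case. Qed.
HB.instance Definition _ :=
  Finite.copy (boundary m n) (can_type boundary_codeK).

Definition piece_code (e : piece m n) :=
  match e with Hor i k => inl (i, k) | Ver k j => inr (k, j) end.
Definition piece_decode (u : ('I_m * 'I_n.+1) + ('I_m.+1 * 'I_n)) :=
  match u with inl (i, k) => Hor i k | inr (k, j) => Ver k j end.
Lemma piece_codeK : cancel piece_code piece_decode.
Proof. by case. Qed.
HB.instance Definition _ := Finite.copy (piece m n) (can_type piece_codeK).

End FiniteTypes.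

Section CatalanStates.
Variables m n : nat.

(* Position on the boundary, clockwise from the top left corner. *)
Definition clockwise (p : boundary m n) : nat :=
  match p with
  | Top j => j
  | Right i => n + i
  | Bottom j => n + m + rev_ord j
  | Left i => n + m + n + rev_ord i
  end%N.

Definition perfect_matching (M : {set {set boundary m n}}) : bool :=
  partition M [set: boundary m n] && [forall B in M, #|B| == 2%N].

Definition noncrossing (M : {set {set boundary m n}}) : bool :=
  [forall B in M, forall B' in M,
   forall a in B, forall b in B', forall c in B, forall d in B',
     ~~ [&& clockwise a < clockwise b, clockwise b < clockwise c
          & clockwise c < clockwise d]%N].

Record catalan_state : Type := CatalanState {
  arcs :> {set {set boundary m n}};
  arcsP : perfect_matching arcs && noncrossing arcs }.

HB.instance Definition _ := [isSub for arcs].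
HB.instance Definition _ := [Finite of catalan_state by <:].

End CatalanStates.

Section KauffmanStates.
Variables m n : nat.

(* The pieces meeting at the crossing c = (i, j) of row i and column j. *)
Definition left_end (c : 'I_m * 'I_n) : piece m n :=
  Hor c.1 (widen_ord (leqnSn n) c.2).
Definition right_end (c : 'I_m * 'I_n) : piece m n := Hor c.1 (lift ord0 c.2).
Definition top_end (c : 'I_m * 'I_n) : piece m n :=
  Ver (widen_ord (leqnSn m) c.1) c.2.
Definition bottom_end (c : 'I_m * 'I_n) : piece m n := Ver (lift ord0 c.1) c.2.

Definition piece_at (p : boundary m n) : piece m n :=
  match p with
  | Top j => Ver ord0 j
  | Bottom j => Ver ord_max j
  | Left i => Hor i ord0
  | Right i => Hor i ord_max
  end.

(* true encodes +1 and false encodes -1. *)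
Definition kauffman_state := {ffun 'I_m * 'I_n -> bool}.

Variable s : kauffman_state.

Definition num_plus : nat := #|[set c | s c]|.
Definition num_minus : nat := #|[set c | ~~ s c]|.

Definition smoothing_arcs (c : 'I_m * 'I_n) : seq (piece m n * piece m n) :=
  if s c then [:: (top_end c, right_end c); (left_end c, bottom_end c)]
  else [:: (top_end c, left_end c); (right_end c, bottom_end c)].

Definition joined : rel (piece m n) := fun e e' =>
  [exists c, ((e, e') \in smoothing_arcs c) || ((e', e) \in smoothing_arcs c)].

(* The connected components of D_s, each given by its set of pieces. *)
Definition components : {set {set piece m n}} :=
  equivalence_partition (connect joined) [set: piece m n].

Definition closed_component (K : {set piece m n}) : bool :=
  [forall p, piece_at p \notin K].

Definition num_closed : nat := #|[set K in components | closed_component K]|.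

(* C_s: each remaining component is recorded by the boundary points on it. *)
Definition state_arcs : {set {set boundary m n}} :=
  [set piece_at @^-1: K | K : {set piece m n} in components
                        & ~~ closed_component K].

End KauffmanStates.

Definition catalan_coef (m n : nat) (C : catalan_state m n) : laurent :=
  \sum_(s : kauffman_state m n | state_arcs s == C)
     Apow ((num_plus s)%:Z - (num_minus s)%:Z)
     * (- Apow 2 - Apow (- 2)) ^+ num_closed s.

(* Main.v *)
Require Import Defs.
From mathcomp Require Import all_boot all_order all_algebra.
From mathcomp Require Import boolp zify ring.

Set Implicit Arguments.
Unset Strict Implicit.
Unset Printing Implicit Defensive.

Import GRing.Theory Num.Theory.

(* Build the lattice crossing from the bottom row upwards. If the rows below row
   t contain an arc joining columns a < b from above (a "cap"), the strand of row
   t can be pulled across it: by the Reidemeister II cancellation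
   A^2 + A^(-2) + (- A^2 - A^(-2)) = 0, the three choices of markers other than
   (+, -) at (t, a), (t, b) contribute zero in total. Hence C(A) is the sum of
   A^(p(s) - n(s)) over the "good" states s with C_s = C, those with markers
   (+, -) at every cap; and good states have no closed components. The caps of a
   good state are known combinatorially: a row with markers rho keeps the old
   caps and adds a cap (a, b) for consecutive cap-free columns a < b with
   rho a = + and rho b = -. *)

(** * Caps *)

Section CapSystems.
Variable n : nat.
Implicit Types P : nat -> nat -> Prop.

(* The columns a, ..., l - 1 are filled by caps placed side by side (and by
   whatever lies under them). *)
Inductive span P : nat -> nat -> Prop :=
| span_nil a : span P a a
| span_cons a b l : P a b -> span P b.+1 l -> span P a l.

Definition linked P a b := P a b \/ P b a.

Definition free P a := forall b, ~ linked P a b.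

Definition planar P :=
  (forall a b, P a b -> [/\ a < b, b < n & span P a.+1 b]) /\
  (forall a b c, linked P a b -> linked P a c -> b = c).

Lemma linkedC P a b : linked P a b -> linked P b a.
Proof. by case; [right | left]. Qed.

Lemma sub_span P P' a b :
  (forall c d, P c d -> P' c d) -> span P a b -> span P' a b.
Proof.
move=> sub; elim=> [c|c d l Pcd _ IH]; first exact: span_nil.
exact: span_cons (sub _ _ Pcd) IH.
Qed.

Lemma span_le P a b : planar P -> span P a b -> a <= b.
Proof.
by move=> [lt _]; elim=> [c|c d l /lt [? _ _] _ ?]; lia.
Qed.

Lemma span_partner P a b c : planar P -> span P a b -> a <= c < b ->
  exists2 d, a <= d < b & linked P c d.
Proof.
move=> plP; have [k] := ubnP (b - a); elim: k a b => // k IHk a b ltk sp.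
case: sp ltk => [l|{}a d {}b Pad sp] ltk ac; first lia.
have [/(_ _ _ Pad)[ltad _ spad] _] := plP; have led := span_le plP sp.
have [eqa|nea] := eqVneq a c; first by exists d; [lia | left; rewrite -eqa].
have [eqd|ned] := eqVneq d c; first by exists a; [lia | right; rewrite -eqd].
have [ltc|lec] := ltnP c d.
  by have [||e ? Pe] := IHk _ _ _ spad; [lia | lia | exists e => //; lia].
by have [||e ? Pe] := IHk _ _ _ sp; [lia | lia | exists e => //; lia].
Qed.

Lemma span_not_free P a b c : planar P -> span P a b -> a <= c < b ->
  ~ free P c.
Proof. by move=> plP sp /(span_partner plP sp) [d _ Pcd] /(_ d). Qed.

Lemma span_of_partners P a b : planar P -> a <= b ->
    (forall c, a <= c < b -> exists2 d, a <= d < b & linked P c d) ->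
  span P a b.
Proof.
move=> plP; have [k] := ubnP (b - a); elim: k a => // k IHk a ltk leab part.
have [->|neab] := eqVneq a b; first exact: span_nil.
have [lt uniq] := plP.
have [|d ltd Pad] := part a; first lia.
have {}Pad : P a d by case: Pad => // /lt[]; lia.
have [ltad _ spad] := lt _ _ Pad.
apply: (span_cons Pad); apply: IHk => [||c ltc]; [lia | lia |].
have [|e lte Pce] := part c; first lia.
exists e => //; rewrite ltnNge; apply/andP; split; last lia.
apply/negP => le_ed; have Pec := linkedC Pce.
have [e_in|[eqe|eqe]] : a < e < d \/ e = a \/ e = d by lia.
- have [f ltf Pef] := span_partner plP spad e_in.
  by have := uniq _ _ _ Pec Pef; lia.
- by move: Pec; rewrite eqe => /(uniq _ _ _ (or_introl Pad)); lia.
- by move: Pec; rewrite eqe => /(uniq _ _ _ (or_intror Pad)); lia.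
Qed.

(* The caps seen from above after adding a row with markers [rho]: the old ones,
   and those that the row closes up between consecutive free columns. *)
Definition cap_step P (rho : nat -> bool) a b :=
  P a b \/
  [/\ b < n, free P a, free P b, span P a.+1 b & rho a /\ ~~ rho b].

Lemma planar_step P rho : planar P -> planar (cap_step P rho).
Proof.
move=> plP; have [lt uniq] := plP.
have sub c d : P c d -> cap_step P rho c d by left.
split=> [a b|].
  case=> [/lt[? ? ?]|[? _ _ sp _]]; split=> //; try exact: sub_span sub _.
  exact: span_le plP sp.
have mixed a b c : linked P a b -> linked (cap_step P rho) a c -> linked P a c.
  move=> Pab [] [Pac|[_ fa fc _ _]]; try by [left | right].
    by case: (fa b).
  by case: (fc b).
move=> a b c Sab Sac.
have [[d Pad]|Nad] := pselect (exists d, linked P a d).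
  by apply: (uniq a); [exact: mixed Pad Sab | exact: mixed Pad Sac].
have new e : linked (cap_step P rho) a e ->
    free P a /\ free P e /\ (if rho a then span P a.+1 e else span P e.+1 a).
  case=> -[Pae|[_ f1 f2 sp [r1 r2]]].
  - by case: Nad; exists e; left.
  - by rewrite r1.
  - by case: Nad; exists e; right.
  - by rewrite (negPf r2).
have {Sab}[fa [fb spb]] := new _ Sab; have {Sac}[_ [fc spc]] := new _ Sac.
have [ltbc|ltcb|//] := ltngtP b c; case: (rho a) spb spc => spb spc.
- by case: (span_not_free plP spc _ fb); have := span_le plP spb; lia.
- by case: (span_not_free plP spb _ fc); have := span_le plP spc; lia.
- by case: (span_not_free plP spb _ fc); have := span_le plP spc; lia.
- by case: (span_not_free plP spc _ fb); have := span_le plP spb; lia.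
Qed.

Fixpoint cap (r : nat -> nat -> bool) t : nat -> nat -> Prop :=
  if t is t'.+1 then cap_step (cap r t') (r t') else fun _ _ => False.

Lemma planar_cap r t : planar (cap r t).
Proof.
elim: t => [|t IHt]; last exact: planar_step.
by split=> // a b c [].
Qed.

Lemma eq_cap r r' t : (forall u, u < t -> r u =1 r' u) -> cap r t = cap r' t.
Proof.
elim: t => //= t IHt eq_r; rewrite IHt => [|u ltu]; last by apply: eq_r; lia.
by rewrite (funext (eq_r t _)).
Qed.

Definition good r t := forall a b, cap r t a b -> r t a /\ ~~ r t b.

Lemma cap_stepP r t a b : good r t -> cap r t.+1 a b ->
  [/\ r t a, ~~ r t b & span (cap r t) a.+1 b].
Proof.
move=> gd [Pab|[_ _ _ sp [? ?]]]; last by [].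
by have [ra rb] := gd _ _ Pab; have [/(_ _ _ Pab)[]] := planar_cap r t.
Qed.

Lemma span_between P x y : planar P -> x <= y <= n ->
    (x = 0 \/ free P x.-1) -> (y = n \/ free P y) ->
    (forall c, x <= c < y -> ~ free P c) ->
  span P x y.
Proof.
move=> plP lexy fx fy nfree; have [lt uniq] := plP.
apply: span_of_partners => // [|c ltc]; first lia.
have /existsNP[d /contrapT Pcd] := nfree _ ltc; exists d => //.
apply/andP; split; rewrite leqNgt; apply/negP => ltd.
- have {}fx : free P x.-1 by case: fx => //; lia.
  have [eqd|ned] := eqVneq d x.-1.
    by apply: (fx c); apply: linkedC; rewrite -eqd.
  case: Pcd => /lt[ltcd ltn sp]; first lia.
  by apply: (span_not_free plP sp _ fx); lia.
- case: Pcd => /[dup] Pcd /lt[ltcd ltn sp]; last lia.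
  have {}fy : free P y by case: fy => //; lia.
  have [eqd|ned] := eqVneq d y; first by apply: (fy c); right; rewrite -eqd.
  by apply: (span_not_free plP sp _ fy); lia.
Qed.

Lemma next_free P x : x <= n ->
  exists y, [/\ x <= y <= n, y = n \/ free P y
    & forall c, x <= c < y -> ~ free P c].
Proof.
have [k] := ubnP (n - x); elim: k x => // k IHk x ltk lex.
have [eqx|nex] := eqVneq x n.
  by exists n; split=> [||c]; [lia | left | lia].
have [fx|nfx] := pselect (free P x).
  by exists x; split=> [||c]; [lia | right | lia].
have [||y [ley fy nfy]] := IHk x.+1; [lia | lia |].
exists y; split=> // [|c lec]; first lia.
by have [->//|?] := eqVneq c x; apply: nfy; lia.
Qed.

Lemma prev_free P y :
  exists x, [/\ x <= y, x = 0 \/ free P x.-1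
    & forall c, x <= c < y -> ~ free P c].
Proof.
elim: y => [|y [x [lex fx nfx]]]; first by exists 0; split=> //; left.
have [fy|nfy] := pselect (free P y).
  by exists y.+1; split=> [||c]; [lia | right | lia].
exists x; split=> // [|c lec]; first lia.
by have [->//|?] := eqVneq c y; apply: nfx; lia.
Qed.

(* Rows are numbered from 0 upwards, starting at the bottom. The crossing (t, j)
   has left end [H t j], right end [H t j.+1], bottom end [V t j] and top end
   [V t.+1 j]. *)
Inductive place : Type := H of nat & nat | V of nat & nat.

Implicit Types (r : nat -> nat -> bool) (Q X Y : place -> Prop).

Definition respects r Q t j : Prop :=
  if r t j then (Q (V t.+1 j) <-> Q (H t j.+1)) /\ (Q (H t j) <-> Q (V t j))
  else (Q (V t.+1 j) <-> Q (H t j)) /\ (Q (H t j.+1) <-> Q (V t j)).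

Definition respects_below r Q t :=
  forall u j, u < t -> j < n -> respects r Q u j.

Lemma respects_out r Q t j : ~ Q (V t.+1 j) -> ~ Q (V t j) -> ~ Q (H t j) ->
  ~ Q (H t j.+1) -> respects r Q t j.
Proof. by rewrite /respects; case: (r t j) => *; split; tauto. Qed.

(* [X] is the set of pieces of the arc under the cap (a, b). *)
Definition cap_region r t a b X :=
  [/\ X (V t a) /\ X (V t b),
      forall u l, X (H u l) -> u < t /\ 0 < l < n,
      forall u j, X (V u j) -> 0 < u <= t /\ (u = t -> j = a \/ j = b),
      respects_below r X t
    & forall Q, respects_below r Q t -> forall x, X x -> (Q x <-> Q (V t a))].

(* [Y] is the set of pieces of the strand that enters row t between the columns
   l - 1 and l and leaves it between the columns l' - 1 and l'. *)
Definition span_region r t l l' Y :=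
  [/\ Y (H t l) /\ Y (H t l'),
      forall u x, Y (H u x) -> u < t /\ 0 < x < n \/ u = t /\ l <= x <= l',
      forall u j, Y (V u j) -> 0 < u <= t /\ (u = t -> l <= j < l'),
      respects_below r Y t /\ (forall j, l <= j < l' -> respects r Y t j)
    & forall Q, respects_below r Q t ->
      (forall j, l <= j < l' -> respects r Q t j) ->
      forall x, Y x -> (Q x <-> Q (H t l))].

Lemma respects_or r X Y t j :
  respects r X t j -> respects r Y t j ->
  respects r (fun x => X x \/ Y x) t j.
Proof. by rewrite /respects; case: (r t j) => *; split; tauto. Qed.

Lemma exists_span_region r t l l' :
    (forall a b, cap r t a b -> exists X, cap_region r t a b X) ->
    (forall a b, l <= a -> b < l' -> cap r t a b -> r t a /\ ~~ r t b) ->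
    l' <= n -> span (cap r t) l l' ->
  exists Y, span_region r t l l' Y.
Proof.
move=> regs gd ltl' sp; have plP := planar_cap r t.
elim: sp gd ltl' => [a|a b {}l' Pab spb IH] gd ltn.
  exists (fun x => x = H t a); split=> //.
  - by move=> u x [-> ->]; right; split=> //; lia.
  - split=> [u j ltu ltj|j]; last lia.
    by apply: respects_out => // -[]; lia.
  - by move=> Q _ _ x ->.
have [/(_ _ _ Pab)[ltab _ _] _] := plP.
have leb := span_le plP spb.
have [||ra /negbTE rb] := gd _ _ _ _ Pab; [lia | lia |].
have [X [[Xa Xb] XH XV Xlow Xconn]] := regs _ _ Pab.
have [||Y [[Yl Yl'] YH YV [Ylow Yrow] Yconn]] := IH.
- by move=> c d lec; apply: gd; lia.
- by [].
exists (fun x => x = H t a \/ X x \/ Y x); split.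
- by split; [left | right; right].
- move=> u x [[-> ->]|[/XH|/YH [|]]]; [right | left | left | right]; lia.
- move=> u j [//|[/XV[? eqj]|/YV[? ltj]]]; split=> // equ.
    by have [] := eqj equ; lia.
  by have := ltj equ; lia.
- split=> [u j ltu ltj|j ltj].
    apply: respects_or; last by apply: respects_or; [exact: Xlow | exact: Ylow].
    by apply: respects_out => // -[]; lia.
  have nXT : ~ X (V t.+1 j) by move=> /XV[]; lia.
  have nYT : ~ Y (V t.+1 j) by move=> /YV[]; lia.
  have nXL : ~ X (H t j) by move=> /XH[]; lia.
  have nXR : ~ X (H t j.+1) by move=> /XH[]; lia.
  have [ltbj|lejb] := ltnP b j.
    have nXB : ~ X (V t j) by move=> /XV[_ /(_ erefl)]; lia.
    apply: respects_or; first by apply: respects_out => // -[]; lia.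
    by apply: respects_or; [exact: respects_out | apply: Yrow; lia].
  have nYL : ~ Y (H t j) by move=> /YH; lia.
  have nYB : ~ Y (V t j) by move=> /YV[_ /(_ erefl)]; lia.
  have [eqj|neja] := eqVneq j a.
    have nYR : ~ Y (H t j.+1) by move=> /YH; lia.
    subst j; rewrite /respects ra; split; split; try tauto;
      by move=> [|[|]] //; case; lia.
  have [eqj|nejb] := eqVneq j b.
    subst j; rewrite /respects rb; split; split; try tauto;
      by move=> [|[|]] //; case; lia.
  have nYR : ~ Y (H t j.+1) by move=> /YH; lia.
  have nXB : ~ X (V t j) by move=> /XV[_ /(_ erefl)]; lia.
  by apply: respects_out => -[|[|]] //; case; lia.
- move=> Q Qlow Qrow.
  have {}Xconn := Xconn Q Qlow.
  have {}Yconn x : Y x -> Q x <-> Q (H t b.+1).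
    by apply: Yconn => // j ltj; apply: Qrow; lia.
  have := Qrow a; rewrite /respects ra => -[|_ QLB]; first lia.
  have := Qrow b; rewrite /respects rb => -[|_ QRB]; first lia.
  have := Xconn _ Xb.
  by move=> QB x [->|[/Xconn|/Yconn]]; tauto.
Qed.

Lemma exists_cap_region r t a b : (forall u, u < t -> good r u) ->
  cap r t a b -> exists X, cap_region r t a b X.
Proof.
elim: t a b => // t IHt a b gd Pab.
have [ra /negbTE rb sp] := cap_stepP (gd t (ltnSn t)) Pab.
have [/(_ _ _ Pab)[ltab ltbn _] _] := planar_cap r t.+1.
have [|||Y [[Ya Yb] YH YV [Ylow Yrow] Yconn]] := exists_span_region _ _ _ sp.
- by move=> c d; apply: IHt => u ltu; apply: gd; lia.
- by move=> c d _ _; apply: gd.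
- lia.
exists (fun x => (x = V t.+1 a \/ x = V t.+1 b) \/ Y x); split.
- by split; left; [left | right].
- by move=> u x [[]//|/YH]; lia.
- move=> u j [[[-> ->]|[-> ->]]|/YV]; [| |lia].
    by split; [lia | left].
  by split; [lia | right].
- move=> u j ltu ltj.
  have nB : ~ (V u j = V t.+1 a \/ V u j = V t.+1 b) by case=> -[]; lia.
  have [ltut|letu] := ltnP u t.
    apply: respects_or; last exact: Ylow.
    by apply: respects_out => // -[] //; case; lia.
  have eq_u : u = t by lia.
  subst u.
  have nYT : ~ Y (V t.+1 j) by move=> /YV; lia.
  have [eqj|neja] := eqVneq j a.
    have nYB : ~ Y (V t j) by move=> /YV[_ /(_ erefl)]; lia.
    have nYL : ~ Y (H t j) by move=> /YH; lia.
    subst j; rewrite /respects ra; split; split; try tauto;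
      by move=> [[|]|] //; case; lia.
  have [eqj|nejb] := eqVneq j b.
    have nYB : ~ Y (V t j) by move=> /YV[_ /(_ erefl)]; lia.
    have nYR : ~ Y (H t j.+1) by move=> /YH; lia.
    subst j; rewrite /respects rb; split; split; try tauto;
      by move=> [[|]|] //; case; lia.
  apply: respects_or.
    by apply: respects_out => // -[] //; case; lia.
  have [inab|outab] := boolP (a < j < b); first exact: Yrow.
  by apply: respects_out => //;
    [move=> /YV[_ /(_ erefl)] | move=> /YH | move=> /YH];
    lia.
- move=> Q Qlow.
  have Qlow' : respects_below r Q t by move=> u j ltu; apply: Qlow; lia.
  have {}Yconn x : Y x -> Q x <-> Q (H t a.+1).
    by apply: Yconn => // j ltj; apply: Qlow; lia.
  have := Qlow t a; rewrite /respects ra => -[||QTR _]; [lia | lia |].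
  have := Qlow t b; rewrite /respects rb => -[||QTL _]; [lia | lia |].
  have := Yconn _ Yb.
  by move=> QL x [[->|->]|/Yconn]; tauto.
Qed.

Lemma free_reaches_boundary r t Q : (forall u, u < t -> good r u) ->
    respects_below r Q t -> (forall j, j < n -> Q (V 0 j)) ->
    (forall u, u < t -> Q (H u 0) /\ Q (H u n)) ->
  forall j, j < n -> free (cap r t) j -> Q (V t j).
Proof.
elim: t => [|t IHt] gd Qlow Qbot Qside j ltj fj; first exact: Qbot.
have gdt u : u < t -> good r u by move=> ?; apply: gd; lia.
have Qlowt : respects_below r Q t by move=> u i ltu; apply: Qlow; lia.
have {}IHt i : i < n -> free (cap r t) i -> Q (V t i).
  by apply: IHt => // u ltu; apply: Qside; lia.
have plP := planar_cap r t.
have spanQ x y : y <= n -> span (cap r t) x y -> Q (H t x) <-> Q (H t y).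
  move=> ley sp.
  have [|||Y [[_ Yy] _ _ _ Yconn]] := exists_span_region _ _ _ sp => //.
  - by move=> c d; apply: exists_cap_region.
  - by move=> c d _ _; apply: gd.
  by rewrite (Yconn Q) // => i lti; apply: Qlow; lia.
have {}fjt : free (cap r t) j.
  by move=> i [] Pij; apply: (fj i); [left | right]; left.
have := Qlow t j (ltnSn t) ltj; rewrite /respects.
case: ifP => rj [QT _]; apply/QT.
- have [y [ley fy nfy]] := @next_free (cap r t) j.+1 ltj.
  have sp : span (cap r t) j.+1 y by apply: span_between => //; right.
  apply/(spanQ _ _ _ sp); first lia.
  have [->|ney] := eqVneq y n; first by have [] := Qside t (ltnSn t).
  have {}fy : free (cap r t) y by case: fy => //; lia.
  have lty : y < n by lia.
  have := Qlow t y (ltnSn t) lty; rewrite /respects.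
  case: ifP => ry [_ QB]; first by apply/QB; apply: IHt.
  by case: (fj y); left; right; split=> //; rewrite rj ry.
- have [x [lex fx nfx]] := @prev_free (cap r t) j.
  have sp : span (cap r t) x j.
    by apply: span_between => //; [lia | right].
  apply/(spanQ _ _ _ sp); first lia.
  have [->|nex] := eqVneq x 0; first by have [] := Qside t (ltnSn t).
  have {}fx : free (cap r t) x.-1 by case: fx => //; lia.
  have ltx : x.-1 < n by lia.
  have := Qlow t x.-1 (ltnSn t) ltx; rewrite /respects prednK; last lia.
  case: ifP => rx [_ QB]; last by apply/QB; apply: IHt.
  case: (fj x.-1); right; right; split=> //; last by rewrite rx rj.
  by rewrite prednK //; lia.
Qed.

Lemma good_reaches_boundary r t Q : (forall u, u < t -> good r u) ->
    respects_below r Q t -> (forall j, j < n -> Q (V 0 j)) ->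
    (forall u, u < t -> Q (H u 0) /\ Q (H u n)) ->
    (forall j, j < n -> Q (V t j)) ->
  (forall u j, u <= t -> j < n -> Q (V u j)) /\
  (forall u l, u < t -> l <= n -> Q (H u l)).
Proof.
elim: t => [|t IHt] gd Qlow Qbot Qside Qtop.
  by split=> // u j; rewrite leqn0 => /eqP->; apply: Qtop.
have gdt u : u < t -> good r u by move=> ?; apply: gd; lia.
have Qlowt : respects_below r Q t by move=> u i ltu; apply: Qlow; lia.
have Qsidet u : u < t -> Q (H u 0) /\ Q (H u n) by move=> ?; apply: Qside; lia.
have plP := planar_cap r t; have [lt _] := plP.
have QH l : l <= n -> Q (H t l).
  elim/ltn_ind: l => -[|j] IHl lel; first by have [] := Qside t (ltnSn t).
  have := Qlow t j (ltnSn t) lel; rewrite /respects.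
  case: ifP => rj [QT QB]; first by apply/QT; apply: Qtop.
  apply/QB; have [fj|/existsNP[i /contrapT Pij]] := pselect (free (cap r t) j).
    exact: free_reaches_boundary fj.
  case: Pij => Pij; have [] := gd t (ltnSn t) _ _ Pij; first by rewrite rj.
  move=> ri _; have [lti ltj _] := lt _ _ Pij.
  have [X [[_ Xj] _ _ _ Xconn]] := exists_cap_region gdt Pij.
  apply/(Xconn _ Qlowt _ Xj).
  have := Qlow t i (ltnSn t); rewrite /respects ri => -[|_ <-]; first lia.
  by apply: IHl; lia.
have QV j : j < n -> Q (V t j).
  move=> ltj; have := Qlow t j (ltnSn t) ltj; rewrite /respects.
  by case: ifP => _ [_ QB]; apply/QB; apply: QH; lia.
have [IHV IHH] := IHt gdt Qlowt Qbot Qsidet QV.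
split=> u x.
  rewrite leq_eqVlt => /predU1P[->|ltu]; [exact: Qtop | exact: IHV].
by rewrite ltnS leq_eqVlt => /predU1P[->|ltu]; [exact: QH | exact: IHH].
Qed.

(* The strand of row t above a crossed cap (a, b), together with the cap: the
   part of the diagram away from which the markers at (t, a) and (t, b) act. *)
Definition bigon_region r t a b Z :=
  [/\ [/\ Z (H t a.+1), Z (H t b), Z (V t a) & Z (V t b)],
      forall u l, Z (H u l) -> [/\ u <= t, 0 < l < n & u = t -> a < l <= b],
      forall u j, Z (V u j) -> 0 < u <= t,
      forall u j, j < n -> ~ (u = t /\ (j = a \/ j = b)) -> respects r Z u j
    & forall Q,
      (forall u j, u <= t -> j < n -> ~ (u = t /\ (j = a \/ j = b)) ->
         respects r Q u j) ->
      [/\ Q (H t a.+1) <-> Q (H t b), Q (V t a) <-> Q (V t b)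
        & forall x, Z x -> (Q x <-> Q (H t b)) \/ (Q x <-> Q (V t b))]].

Lemma exists_bigon_region r t a b : (forall u, u < t -> good r u) ->
    (forall c d, cap r t c d -> d < b -> r t c /\ ~~ r t d) ->
  cap r t a b -> exists Z, bigon_region r t a b Z.
Proof.
move=> gd gdt Pab.
have [/(_ _ _ Pab)[ltab ltbn sp] _] := planar_cap r t.
have [X [[Xa Xb] XH XV Xlow Xconn]] := exists_cap_region gd Pab.
have [|||Y [[Ya Yb] YH YV [Ylow Yrow] Yconn]] := exists_span_region _ _ _ sp.
- by move=> c d; apply: exists_cap_region.
- by move=> c d _ ltd /gdt; apply.
- lia.
exists (fun x => X x \/ Y x); split.
- by split; tauto.
- by move=> u l [/XH|/YH] ?; split; lia.
- by move=> u j [/XV|/YV]; lia.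
- move=> u j ltj nuj; have [ltut|letu] := ltnP u t.
    by apply: respects_or; [apply: Xlow | apply: Ylow].
  have [ltj'|outj] := boolP ((u == t) && (a < j < b)).
    have eq_u : u = t by lia.
    subst u; apply: respects_or; last by apply: Yrow; lia.
    by apply: respects_out;
      [move=> /XV | move=> /XV[_ /(_ erefl)] | move=> /XH | move=> /XH]; lia.
  by apply: respects_out => -[]; [move=> /XV|move=> /YV|move=> /XV|move=> /YV
    |move=> /XH|move=> /YH|move=> /XH|move=> /YH]; lia.
- move=> Q Qresp.
  have Qlow : respects_below r Q t by move=> u j ltu ltj; apply: Qresp; lia.
  have {}Yconn x : Y x -> Q x <-> Q (H t a.+1).
    by apply: Yconn => // j ltj; apply: Qresp; lia.
  have {}Xconn x : X x -> Q x <-> Q (V t a) by apply: Xconn.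
  have := Yconn _ Yb; have := Xconn _ Xb => QX QY.
  split; [tauto | tauto | move=> x [/Xconn|/Yconn]; tauto].
Qed.

End CapSystems.

(** * Changing the markers at a cap *)

Section Surgery.
Variables (n m t a b : nat) (r r' : nat -> nat -> bool) (Z : place -> Prop).
Hypotheses (ltm : t < m) (ltab : a < b) (ltbn : b < n).
Hypotheses (ra : r t a = false) (rb : r t b = true) (r'ab : r' t a = r' t b).
Hypothesis eq_r : forall u j, ~ (u = t /\ (j = a \/ j = b)) -> r' u j = r u j.
Hypothesis regZ : bigon_region n r t a b Z.

Let o := if r' t a then V t.+1 a else V t.+1 b.

Let respects_eq Q u j : ~ (u = t /\ (j = a \/ j = b)) ->
  respects r' Q u j = respects r Q u j.
Proof. by move=> /eq_r eq_ruj; rewrite /respects eq_ruj. Qed.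

Let in_bigon : [/\ Z (H t a.+1), Z (H t b), Z (V t a) & Z (V t b)].
Proof. by case: regZ. Qed.

Lemma off_bigon :
  [/\ ~ Z (H t a), ~ Z (H t b.+1), ~ Z (V t.+1 a) & ~ Z (V t.+1 b)].
Proof.
by case: regZ => _ ZH ZV _ _; split; [move=> /ZH | move=> /ZH | move=> /ZV
  | move=> /ZV]; try case; lia.
Qed.

Lemma bigon_respects : respects_below n r Z m.
Proof.
have [_ _ _ Zout _] := regZ; have [? ? ? ?] := in_bigon.
have [? ? ? ?] := off_bigon; move=> u j ltu ltj.
have [[-> [->|->]]|] := pselect (u = t /\ (j = a \/ j = b)).
- by rewrite /respects ra; tauto.
- by rewrite /respects rb; tauto.
- exact: Zout.
Qed.

Lemma bigon_class Q x : respects_below n r Q m -> Z x -> Q x <-> Q (H t b).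
Proof.
move=> Qr; have [_ _ _ _ Zconn] := regZ.
have [|_ QB /(_ x)] := Zconn Q; first by move=> u j ltu ltj _; apply: Qr; lia.
have := Qr t b ltm ltbn; rewrite /respects rb; tauto.
Qed.

Lemma bigon_merged Q x : respects_below n r' Q m -> Z x -> Q x <-> Q o.
Proof.
move=> Qr; have [_ _ _ _ Zconn] := regZ.
have [|QR QB /(_ x)] := Zconn Q.
  by move=> u j leu ltj nuj; rewrite -respects_eq //; apply: Qr; lia.
have := Qr t b ltm ltbn; have := Qr t a ltm (ltn_trans ltab ltbn).
rewrite /respects /o -r'ab; case: (r' t a); tauto.
Qed.

Lemma bigon_open Q : respects_below n r Q m ->
  respects_below n r' (fun x => Z x /\ Q o \/ ~ Z x /\ Q x) m.
Proof.
move=> Qr u j ltu ltj; have [? ? ? ?] := in_bigon.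
have [? ? ? ?] := off_bigon.
have := Qr t b ltm ltbn; have := Qr t a ltm (ltn_trans ltab ltbn).
rewrite {1 2}/respects ra rb => Qa Qb.
have [[-> [->|->]]|] := pselect (u = t /\ (j = a \/ j = b)).
- by rewrite /respects /o; case: (r' t a); tauto.
- by rewrite /respects /o -r'ab; case: (r' t a); tauto.
move=> nuj; rewrite respects_eq //.
by have := Qr u j ltu ltj; have := bigon_respects ltu ltj;
  rewrite /respects; case: (r u j); tauto.
Qed.

Lemma bigon_close Q : respects_below n r' Q m ->
  respects_below n r (fun x => ~ Z x /\ Q x) m.
Proof.
move=> Qr u j ltu ltj; have [Z1 Z2 Z3 Z4] := in_bigon.
have [? ? ? ?] := off_bigon.
have := bigon_merged Qr Z1; have := bigon_merged Qr Z2.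
have := bigon_merged Qr Z3; have := bigon_merged Qr Z4.
have := Qr t b ltm ltbn; have := Qr t a ltm (ltn_trans ltab ltbn).
rewrite {1 2}/respects -r'ab => Qa Qb Q4 Q3 Q2 Q1.
have [[-> [->|->]]|] := pselect (u = t /\ (j = a \/ j = b)).
- by rewrite /respects ra; move: Qa Qb; case: (r' t a); tauto.
- by rewrite /respects rb; move: Qa Qb; case: (r' t a); tauto.
move=> nuj; have := Qr u j ltu ltj; rewrite respects_eq //.
by have := bigon_respects ltu ltj; rewrite /respects; case: (r u j); tauto.
Qed.

End Surgery.

Section StateGraph.
Variables m n : nat.
Implicit Types (s : kauffman_state m n) (x y o : piece m n).
Implicit Types Z K : {set piece m n}.

Lemma connect_joined_sym s : connect_sym (joined s).
Proof.
apply: sym_connect_sym => x y; rewrite /joined.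
by apply: eq_existsb => c; rewrite orbC.
Qed.

Definition strand s x : {set piece m n} := [set y | connect (joined s) x y].

Lemma strand_eq s x y : y \in strand s x -> strand s y = strand s x.
Proof.
rewrite inE => xy; apply/setP => z; rewrite !inE; symmetry.
exact: (same_connect (connect_joined_sym s)).
Qed.

Lemma componentsP s K :
  reflect (exists x, K = strand s x) (K \in components s).
Proof.
apply: (iffP imsetP) => [[x _ ->]|[x ->]]; exists x => //.
all: by apply/setP => y; rewrite !inE.
Qed.

Lemma state_arcsE s :
  state_arcs s =
    [set @piece_at m n @^-1: strand s (piece_at p) | p : boundary m n].
Proof.
apply/setP => B; apply/imsetP/imsetP => [[K]|[p _ ->]].
  rewrite inE => /andP[/componentsP[x ->] /forallPn[p]]; rewrite negbK => px ->.
  by exists p; rewrite // (strand_eq px).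
exists (strand s (piece_at p)) => //; rewrite inE; apply/andP; split.
  by apply/componentsP; exists (piece_at p).
by apply/forallPn; exists p; rewrite negbK inE connect0.
Qed.

Lemma eq_state_arcs s s' Z : (forall p, piece_at p \notin Z) ->
    {in ~: Z &, connect (joined s) =2 connect (joined s')} ->
  state_arcs s = state_arcs s'.
Proof.
move=> ZB eqZ; rewrite !state_arcsE; apply: eq_imset => p.
by apply/setP => q; rewrite !inE eqZ ?inE.
Qed.

Lemma num_closed_surgery s s' Z o z : (forall p, piece_at p \notin Z) ->
    {in ~: Z &, connect (joined s) =2 connect (joined s')} ->
    o \notin Z -> {in Z, forall x, connect (joined s) o x} ->
    z \in Z -> strand s' z = Z ->
  num_closed s' = (num_closed s).+1.
Proof.
move=> ZB eqZ oNZ oZ zZ clZ; rewrite /num_closed.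
have strandZ x : x \notin Z -> strand s' x = strand s x :\: Z.
  move=> xNZ; apply/setP => y; rewrite !inE; have [yZ|yNZ] := boolP (y \in Z).
    apply: contraNF xNZ => xy; rewrite -clZ in yZ *.
    by rewrite -(strand_eq yZ) inE connect_joined_sym.
  by rewrite eqZ ?inE.
have repr x : exists2 y, y \notin Z & strand s x = strand s y.
  have [xZ|xNZ] := boolP (x \in Z); last by exists x.
  by exists o => //; apply: strand_eq; rewrite inE oZ.
have closedD K : closed_component (K :\: Z) = closed_component K.
  by apply: eq_forallb => p; rewrite inE ZB.
have -> : [set K in components s' | closed_component K] =
    Z |: [set K :\: Z | K in [set K in components s | closed_component K]].
  apply/setP => K; rewrite inE in_setU1; apply/andP/orP.
    move=> [/componentsP[x ->] clK]; have [xZ|xNZ] := boolP (x \in Z).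
      by left; rewrite -clZ; apply/eqP/strand_eq; rewrite clZ.
    right; apply/imsetP; exists (strand s x); last exact: strandZ.
    rewrite inE -closedD -strandZ // clK andbT.
    by apply/componentsP; exists x.
  move=> [/eqP->|/imsetP[K']].
    split; last by apply/forallP => p.
    by apply/componentsP; exists z.
  rewrite inE => /andP[/componentsP[x ->]]; have [y yNZ ->] := repr x.
  move=> cly ->; rewrite closedD; split=> //.
  by apply/componentsP; exists y; rewrite strandZ.
rewrite cardsU1 card_in_imset.
  case: imsetP => [[K _ eqK]|//].
  by have := zZ; rewrite {1}eqK inE zZ.
move=> K K'; rewrite !inE => /andP[/componentsP[x ->] _].
move=> /andP[/componentsP[x' ->] _].
have [y yNZ ->] := repr x; have [y' y'NZ ->] := repr x' => eqD.
apply/esym/strand_eq; have : y' \in strand s y' :\: Z by rewrite !inE y'NZ /=.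
by rewrite -eqD inE => /andP[].
Qed.

Definition place_of x : place :=
  match x with
  | Hor i l => H (m - i.+1) l
  | Ver k j => V (m - k) j
  end.

Lemma place_of_inj : injective place_of.
Proof.
move=> [i l|k j] [i' l'|k' j'] //= [eq1 eq2].
- have -> : i = i'.
    apply: val_inj => /=.
    by have := ltn_ord i; have := ltn_ord i'; lia.
  by rewrite (val_inj eq2).
- have -> : k = k'.
    apply: val_inj => /=.
    by have := ltn_ord k; have := ltn_ord k'; lia.
  by rewrite (val_inj eq2).
Qed.

(* The markers of [s] with rows counted from the bottom. *)
Definition markers s (u j : nat) : bool :=
  [exists c : 'I_m * 'I_n, [&& m - c.1.+1 == u, c.2 == j :> nat & s c]].

Lemma markersE s (c : 'I_m * 'I_n) : markers s (m - c.1.+1) c.2 = s c.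
Proof.
apply/existsP/idP => [[c' /and3P[/eqP eq1 /eqP eq2]]|sc]; last first.
  by exists c; rewrite !eqxx.
suff -> : c' = c by [].
have := ltn_ord c.1; have := ltn_ord c'.1.
case: c c' eq1 eq2 => [c1 c2] [d1 d2] /= eq1 eq2 lt1 lt2.
by congr (_, _); apply: val_inj => //=; lia.
Qed.

Lemma crossing_at u j : u < m -> j < n ->
  exists c : 'I_m * 'I_n, m - c.1.+1 = u /\ c.2 = j :> nat.
Proof.
move=> ltu ltj; have ltu' : m - u.+1 < m by lia.
by exists (Ordinal ltu', Ordinal ltj) => /=; lia.
Qed.

Lemma place_ends (c : 'I_m * 'I_n) :
  [/\ place_of (top_end c) = V (m - c.1.+1).+1 c.2,
      place_of (bottom_end c) = V (m - c.1.+1) c.2,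
      place_of (left_end c) = H (m - c.1.+1) c.2
    & place_of (right_end c) = H (m - c.1.+1) c.2.+1].
Proof. by rewrite /= /bump /= !add1n subnSK. Qed.

Definition reach s x : place -> Prop :=
  fun p => exists2 y, place_of y = p & connect (joined s) x y.

Lemma reachE s x y : reach s x (place_of y) <-> connect (joined s) x y.
Proof.
by split=> [[z /place_of_inj->]|xy]; last exists y.
Qed.

Lemma respects_reach s x : respects_below n (markers s) (reach s x) m.
Proof.
move=> u j /crossing_at/[apply] -[c [<- <-]].
rewrite /respects markersE; have [<- <- <- <-] := place_ends c.
have conn y z : (y, z) \in smoothing_arcs s c ->
    reach s x (place_of y) <-> reach s x (place_of z).
  move=> yz; rewrite !reachE.
  have e_yz : joined s y z by apply/existsP; exists c; rewrite yz.
  have e_zy : joined s z y by apply/existsP; exists c; rewrite yz orbT.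
  by split=> /connect_trans -> //; apply: connect1.
rewrite /smoothing_arcs in conn.
by case: ifP conn => _ conn; split; apply: conn; rewrite !inE eqxx ?orbT.
Qed.

Lemma respects_connect s Q x y : respects_below n (markers s) Q m ->
  connect (joined s) x y -> Q (place_of x) -> Q (place_of y).
Proof.
move=> Qr /connectP[p]; elim: p x => [|z p IHp] x /=; first by move=> _ ->.
move=> /andP[/existsP[c xz] path_p] eq_y Qx.
apply: IHp path_p eq_y _.
have ltc : m - c.1.+1 < m by have := ltn_ord c.1; lia.
have := Qr _ _ ltc (ltn_ord c.2); rewrite /respects markersE.
have [<- <- <- <-] := place_ends c.
move: xz Qx; rewrite /smoothing_arcs.
by case: ifP => _; rewrite !inE -!orbA => /or4P[] /eqP[-> ->]; tauto.
Qed.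

End StateGraph.

(** * Cancellation of the bad states *)

Definition first_bad n r t a b :=
  [/\ forall u, u < t -> good n r u, cap n r t a b, ~ (r t a /\ ~~ r t b)
    & forall c d, cap n r t c d -> d < b -> r t c /\ ~~ r t d].

Lemma first_bad_uniq n r t a b t' a' b' :
  first_bad n r t a b -> first_bad n r t' a' b' ->
  [/\ t = t', a = a' & b = b'].
Proof.
move=> [low Pab bad left_good] [low' Pab' bad' left_good'].
have [/low'/(_ _ _ Pab)//|/low/(_ _ _ Pab')//|eqt] := ltngtP t t'.
subst t'; have [lt|lt|eqb] := ltngtP b b'.
- by case: bad; apply: left_good' Pab lt.
- by case: bad'; apply: left_good Pab' lt.
- subst b'; split=> //; have [_ uniq] := planar_cap n r t.
  by apply: (uniq b); right.
Qed.

Lemma exists_first_bad n r m : ~ (forall u, u < m -> good n r u) ->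
  exists t a b, t < m /\ first_bad n r t a b.
Proof.
elim: m => [|m IHm] bad; first by case: bad.
have [low|nlow] := pselect (forall u, u < m -> good n r u); last first.
  by have [t [a [b [ltm fb]]]] := IHm nlow; exists t, a, b; split=> //; lia.
have Nm : ~ good n r m.
  move=> gm; apply: bad => u; rewrite ltnS leq_eqVlt => /predU1P[->//|].
  exact: low.
pose bad_cap b := `[< exists a, cap n r m a b /\ ~ (r m a /\ ~~ r m b) >].
have ex_b : exists b, bad_cap b.
  apply: contrapT => nb; apply: Nm => a b Pab; apply: contrapT => bad_ab.
  by apply: nb; exists b; apply/asboolP; exists a.
have [b /asboolP[a [Pab bad_ab]] minb] := ex_minnP ex_b.
exists m, a, b; split=> //; split=> // c d Pcd ltd; apply: contrapT => bad_cd.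
have : bad_cap d by apply/asboolP; exists c.
by move=> /minb; lia.
Qed.

Lemma first_bad_eq n (r r' : nat -> nat -> bool) t a b :
    (forall u j, ~ (u = t /\ (j = a \/ j = b)) -> r' u j = r u j) ->
    ~ (r' t a /\ ~~ r' t b) ->
  first_bad n r t a b -> first_bad n r' t a b.
Proof.
move=> eq_r bad' [low Pab _ left_good].
have eq_c u : u <= t -> cap n r' u = cap n r u.
  by move=> leu; apply: eq_cap => v ltv j; apply: eq_r; lia.
have [lt uniq] := planar_cap n r t; have [ltab _ _] := lt _ _ Pab.
split=> // [u ltu c d| |c d]; rewrite eq_c //; last first.
- move=> Pcd ltd; have [ltcd _ _] := lt _ _ Pcd.
  rewrite !eq_r; first exact: left_good Pcd ltd.
    move=> [_ [eqd|]]; last lia.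
    have : linked (cap n r t) a c by right; rewrite -eqd.
    by move=> /(uniq _ _ _ (or_introl Pab)); lia.
  move=> [_ [eqc|]]; last lia.
  have : linked (cap n r t) a d by left; rewrite -eqc.
  by move=> /(uniq _ _ _ (or_introl Pab)); lia.
- by exact: ltnW.
by move=> Pcd; rewrite !eq_r; [exact: low Pcd | lia | lia].
Qed.

Section BadStates.
Variables m n : nat.
Implicit Types s : kauffman_state m n.

Lemma markers_away s s' (i : 'I_m) (a b : 'I_n) :
    (forall c, c != (i, a) -> c != (i, b) -> s' c = s c) ->
  forall u j : nat, ~ (u = m - i.+1 /\ (j = a \/ j = b)) ->
  markers s' u j = markers s u j.
Proof.
move=> eq_s u j nuj; apply: eq_existsb => c.
have [/eqP eq1|//] := boolP (_ == u); have [/eqP eq2|//] := boolP (_ == j).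
rewrite /= eq_s //; apply/eqP => eqc; apply: nuj; rewrite -eq1 -eq2 eqc /=.
  by split; [|left].
by split; [|right].
Qed.

Lemma bigon_off_boundary r t a b Z (p : boundary m n) : (t < m)%N ->
  bigon_region n r t a b Z -> ~ Z (place_of (piece_at p)).
Proof.
move=> ltm [_ ZH ZV _ _].
by case: p => j /=;
  [move=> /ZV | move=> /ZV | move=> /ZH[_] | move=> /ZH[_]]; lia.
Qed.

Lemma bad_cap_surgery s s' (i : 'I_m) (a b : 'I_n) :
    first_bad n (markers s) (m - i.+1) a b ->
    s (i, a) = false -> s (i, b) = true -> s' (i, a) = s' (i, b) ->
    (forall c, c != (i, a) -> c != (i, b) -> s' c = s c) ->
  state_arcs s' = state_arcs s /\ num_closed s = (num_closed s').+1.
Proof.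
set t := m - i.+1; move=> [low Pab _ left_good] sa sb s'ab eq_s.
have ltm : t < m by have := ltn_ord i; lia.
have [/(_ _ _ Pab)[ltab ltbn _] _] := planar_cap n (markers s) t.
have [Z regZ] := exists_bigon_region low left_good Pab.
have ra : markers s t a = false by rewrite (markersE s (i, a)).
have rb : markers s t b = true by rewrite (markersE s (i, b)).
have r'a : markers s' t a = s' (i, a) by rewrite (markersE s' (i, a)).
have r'ab : markers s' t a = markers s' t b.
  by rewrite (markersE s' (i, a)) (markersE s' (i, b)).
have eq_r := markers_away eq_s.
pose Zs := [set x : piece m n | `[< Z (place_of x) >]].
have ZsP x : reflect (Z (place_of x)) (x \in Zs).
  by rewrite inE; apply: asboolP.
have [[Z1 Z2 Z3 Z4] _ _ _ _] := regZ.
have ZB (p : boundary m n) : piece_at p \notin Zs.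
  by apply/ZsP; exact: bigon_off_boundary regZ.
have [_ _ ZTa ZTb] := off_bigon ltm ltab ltbn ra rb r'ab regZ.
have surg_open := bigon_open ltm ltab ltbn ra rb r'ab eq_r regZ.
have surg_close := bigon_close ltm ltab ltbn ra rb r'ab eq_r regZ.
have eqZ : {in ~: Zs &, connect (joined s') =2 connect (joined s)}.
  move=> x y; rewrite !in_setC => /ZsP xNZ /ZsP yNZ; apply/idP/idP => xy.
    have := surg_open _ (respects_reach s x).
    move=> /respects_connect/(_ xy) open_xy; apply/(reachE s).
    have : reach s x (place_of x) by apply/reachE/connect0.
    by tauto.
  have := surg_close _ (respects_reach s' x).
  move=> /respects_connect/(_ xy) close_xy; apply/(reachE s').
  have : reach s' x (place_of x) by apply/reachE/connect0.
  by tauto.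
split; first exact: eq_state_arcs ZB eqZ.
have [Ta _ _ _] := place_ends (i, a); have [Tb _ Lb _] := place_ends (i, b).
pose o := if s' (i, a) then top_end (i, a) else top_end (i, b).
have oE : place_of o = if markers s' t a then V t.+1 a else V t.+1 b.
  by rewrite r'a /o; case: ifP.
apply: (@num_closed_surgery _ _ s' s Zs o (left_end (i, b))) => //.
- by apply/ZsP; rewrite oE; case: ifP.
- move=> x /ZsP xZ; apply/(reachE s').
  have Q_o := respects_reach s' o.
  have mer := bigon_merged ltm ltab ltbn ra rb r'ab eq_r regZ Q_o xZ.
  apply/mer.
  by rewrite -oE; apply/reachE.
- by apply/ZsP; rewrite Lb.
- apply/setP => x; rewrite inE; apply/idP/ZsP.
    move=> /(respects_connect (bigon_respects ltm ltab ltbn ra rb r'ab regZ)).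
    by rewrite Lb; apply.
  move=> xZ; apply/(reachE s).
  apply/(bigon_class ltm ltab ltbn ra rb r'ab regZ (respects_reach s _) xZ).
  by rewrite -Lb; apply/reachE.
Qed.

Lemma good_no_closed s : (forall u, u < m -> good n (markers s) u) ->
  num_closed s = 0.
Proof.
move=> gd; apply/eqP; rewrite cards_eq0; apply/eqP/setP => K; rewrite !inE.
apply/negP => /andP[/componentsP[x ->] /forallP clK].
pose Q p := ~ reach s x p.
have Qr : respects_below n (markers s) Q m.
  move=> u j ltu ltj; have := respects_reach s x ltu ltj.
  by rewrite /respects /Q; case: ifP; tauto.
have Qb (p : boundary m n) : Q (place_of (piece_at p)).
  by move=> reach_p; have := clK p; rewrite inE => /negP; apply; apply/reachE.
have Q0 j : j < n -> Q (V 0 j).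
  by move=> ltj; have := Qb (Bottom (Ordinal ltj)); rewrite /= subnn.
have Qm j : j < n -> Q (V m j).
  by move=> ltj; have := Qb (Top (Ordinal ltj)); rewrite /= subn0.
have Qs u : u < m -> Q (H u 0) /\ Q (H u n).
  move=> ltu; have ltu' : m - u.+1 < m by lia.
  have := Qb (Left (Ordinal ltu')); have := Qb (Right (Ordinal ltu')).
  by rewrite /=; have -> : m - (m - u.+1).+1 = u by lia.
have [QV QH] := good_reaches_boundary gd Qr Q0 Qs Qm.
suff QP (y : piece m n) : Q (place_of y).
  by have := QP x; apply; apply/reachE/connect0.
case: y => [i l|k j]; last by apply: QV; [rewrite /=; lia | exact: ltn_ord].
by apply: QH; [have := ltn_ord i; rewrite /=; lia | have := ltn_ord l; lia].
Qed.

Local Open Scope ring_scope.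

Definition writhe s : int := (num_plus s)%:Z - (num_minus s)%:Z.

Definition state_weight s : laurent :=
  Apow (writhe s) * (- Apow 2 - Apow (- 2)) ^+ num_closed s.

Lemma state_weightE s v k : writhe s = v -> num_closed s = k ->
  state_weight s = Apow v * (- Apow 2 - Apow (- 2)) ^+ k.
Proof. by move=> <- <-. Qed.

Lemma writheE s : writhe s = \sum_c (if s c then 1 else - 1).
Proof.
rewrite /writhe (bigID s) /= (eq_bigr (fun=> 1)) => [|c ->//].
rewrite [X in _ = _ + X](eq_bigr (fun=> - 1)) => [|c /negPf->//].
rewrite !sumr_const mulNrn -!natz.
by congr (_%:R - _%:R); apply: eq_card => c; rewrite inE.
Qed.

Definition mark s (i : 'I_m) (a b : 'I_n) (u v : bool) : kauffman_state m n :=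
  [ffun c => if c == (i, a) then u else if c == (i, b) then v else s c].

Lemma writhe_mark s i a b u v : a != b ->
  writhe (mark s i a b u v) = (if u then 1 else - 1) + ((if v then 1 else - 1) +
    \sum_(c | (c != (i, a)) && (c != (i, b))) (if s c then 1 else - 1)).
Proof.
move=> neab; have ne : (i, b) != (i, a) by rewrite xpair_eqE eqxx eq_sym.
rewrite writheE (bigD1 (i, a)) // (bigD1 (i, b)) //= !ffunE !eqxx (negPf ne).
congr (_ + (_ + _)); apply: eq_bigr => c /andP[/negPf ca /negPf cb].
by rewrite ffunE ca cb.
Qed.

Lemma mark_away s i a b u v c :
  c != (i, a) -> c != (i, b) -> mark s i a b u v c = s c.
Proof. by move=> /negPf ca /negPf cb; rewrite ffunE ca cb. Qed.

Lemma mark_left s i a b u v : mark s i a b u v (i, a) = u.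
Proof. by rewrite ffunE eqxx. Qed.

Lemma mark_right s i a b u v : a != b -> mark s i a b u v (i, b) = v.
Proof. by move=> neab; rewrite ffunE xpair_eqE !eqxx eq_sym (negPf neab). Qed.

Lemma mark_mark s i a b u v u' v' :
  mark (mark s i a b u v) i a b u' v' = mark s i a b u' v'.
Proof. by apply/ffunP => c; rewrite !ffunE; case: (c == _); case: (c == _). Qed.

Lemma mark_id s i a b : mark s i a b (s (i, a)) (s (i, b)) = s.
Proof.
by apply/ffunP => c; rewrite ffunE; case: eqP => [->//|_]; case: eqP => [->|].
Qed.

(* Reidemeister II: [A^2 + A^(-2) + (- A^2 - A^(-2)) = 0]. *)
Lemma skein_cancel (w : int) k (d := - Apow 2 - Apow (- 2)) :
  Apow (1 + (1 + w)) * d ^+ k + (Apow (- 1 + (- 1 + w)) * d ^+ k +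
    Apow (- 1 + (1 + w)) * d ^+ k.+1) = 0.
Proof.
have -> : 1 + (1 + w) = 2 + w by rewrite addrA.
have -> : - 1 + (- 1 + w) = - 2 + w by rewrite addrA.
rewrite addKr (ApowD 2) (ApowD (- 2)) exprS {3}/d.
by move: (Apow 2) (Apow _) (Apow w) (d ^+ k) => p q x y; ring.
Qed.

Lemma bad_cap_cancel s (i : 'I_m) (a b : 'I_n) :
    first_bad n (markers s) (m - i.+1) a b ->
    s (i, a) = false -> s (i, b) = true ->
  [/\ state_arcs (mark s i a b true true) = state_arcs s,
      state_arcs (mark s i a b false false) = state_arcs s
    & state_weight (mark s i a b true true) +
      (state_weight (mark s i a b false false) + state_weight s) = 0].
Proof.
move=> fb sa sb; have [_ Pab _ _] := fb.
have neab : a != b.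
  have [/(_ _ _ Pab)[ltab _ _] _] := planar_cap n (markers s) (m - i.+1).
  by apply/eqP => eqab; rewrite eqab ltnn in ltab.
have surgery u : state_arcs (mark s i a b u u) = state_arcs s /\
    num_closed s = (num_closed (mark s i a b u u)).+1.
  apply: (bad_cap_surgery fb) => // [|c]; last exact: mark_away.
  by rewrite mark_left mark_right.
have [[arcs1 loops1] [arcs2 loops2]] := (surgery true, surgery false).
split=> //; have eq_s : s = mark s i a b false true by rewrite -sa -sb mark_id.
have eq_loops : num_closed (mark s i a b false false) =
    num_closed (mark s i a b true true).
  by apply: succn_inj; exact: etrans (esym loops2) loops1.
pose w : int :=
  \sum_(c | (c != (i, a)) && (c != (i, b))) (if s c then 1 else - 1).
have writhe_s : writhe s = - 1 + (1 + w).
  exact: etrans (congr1 writhe eq_s) (writhe_mark s i false true neab).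
have weight1 := state_weightE (writhe_mark s i true true neab) (erefl _).
have weight2 := state_weightE (writhe_mark s i false false neab) eq_loops.
have weight3 := state_weightE writhe_s loops1.
rewrite weight1 weight2 weight3 -/w.
exact: skein_cancel.
Qed.

Lemma sum_mark_cancel (W : zmodType) (P : pred (kauffman_state m n))
    (wt : kauffman_state m n -> W) (i : 'I_m) (a b : 'I_n) : a != b ->
    (forall s, P s -> ~~ (s (i, a) && ~~ s (i, b))) ->
    (forall s u v, P s -> ~~ (u && ~~ v) -> P (mark s i a b u v)) ->
    (forall s, P s -> s (i, a) = false -> s (i, b) = true ->
       wt (mark s i a b true true) +
         (wt (mark s i a b false false) + wt s) = 0) ->
  \sum_(s | P s) wt s = 0.
Proof.
move=> neab bad Pmark wt0.
pose base s := [&& P s, ~~ s (i, a) & s (i, b)].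
have sum_base u : \sum_(s | [&& P s, s (i, a) == u & s (i, b) == u]) wt s =
    \sum_(s | base s) wt (mark s i a b u u).
  rewrite (reindex_onto (fun s => mark s i a b u u)
    (fun s => mark s i a b false true)) => [|s /and3P[_ /eqP sa /eqP sb]].
    apply: eq_bigl => s; rewrite mark_mark mark_left mark_right // !eqxx !andbT.
    apply/andP/and3P => [[Ps /eqP eqs]|[Ps sa sb]].
      by rewrite -eqs mark_left mark_right // -(mark_mark s i a b u u) Pmark.
    rewrite Pmark ?andbN //.
    by rewrite -[X in _ == X](mark_id s i a b) (negPf sa) sb.
  by rewrite mark_mark -[in RHS](mark_id s i a b) sa sb.
rewrite (bigID (fun s : kauffman_state m n => s (i, a) == s (i, b))) /=.
rewrite (bigID (fun s : kauffman_state m n => s (i, a))) /=.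
have bases u s : (P s && (s (i, a) == s (i, b))) && (s (i, a) == u) =
    [&& P s, s (i, a) == u & s (i, b) == u].
  by case: (s (i, a)); case: (s (i, b)); case: u; rewrite ?andbT ?andbF.
rewrite -(eq_bigl _ _ (fun s => congr1 (andb _) (eqb_id (s (i, a))))).
rewrite -(eq_bigl _ _ (fun s => congr1 (andb _) (eqbF_neg (s (i, a))))).
rewrite (eq_bigl _ _ (bases true)) (eq_bigl _ _ (bases false)) !sum_base.
rewrite (eq_bigl base) => [|s]; last first.
  rewrite /base; case Ps: (P s) => //=; move/bad: Ps.
  by case: (s (i, a)); case: (s (i, b)).
rewrite -addrA -!big_split big1 // => s /and3P[Ps /negPf sa sb].
exact: wt0.
Qed.

Lemma bad_states_cancel (C : {set {set boundary m n}}) (i : 'I_m) (a b : 'I_n) :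
  \sum_(s : kauffman_state m n | (state_arcs s == C) &&
     `[< first_bad n (markers s) (m - i.+1) a b >]) state_weight s = 0.
Proof.
have [eqab|neab] := eqVneq a b.
  rewrite big_pred0 // => s; apply/negP => /andP[_ /asboolP[_ Pab _ _]].
  have [/(_ _ _ Pab)[ltab _ _] _] := planar_cap n (markers s) (m - i.+1).
  by rewrite eqab ltnn in ltab.
have fb_mark s u v : ~~ (u && ~~ v) -> first_bad n (markers s) (m - i.+1) a b ->
    first_bad n (markers (mark s i a b u v)) (m - i.+1) a b.
  move=> uv; apply: first_bad_eq.
    by apply: markers_away => c; apply: mark_away.
  rewrite (markersE _ (i, a)) (markersE _ (i, b)) mark_left mark_right //.
  by case=> u1 v1; rewrite u1 v1 in uv.
have bad s : first_bad n (markers s) (m - i.+1) a b ->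
    ~~ (s (i, a) && ~~ s (i, b)).
  move=> [_ _ bad _]; apply/negP => /andP[sa sb]; apply: bad.
  by rewrite (markersE s (i, a)) (markersE s (i, b)).
have arcs_mark s u v : first_bad n (markers s) (m - i.+1) a b ->
    s (i, a) = false -> s (i, b) = true -> ~~ (u && ~~ v) ->
    state_arcs (mark s i a b u v) = state_arcs s.
  move=> fbs sa sb; have [arcs1 arcs2 _] := bad_cap_cancel fbs sa sb.
  have eq_s : mark s i a b false true = s by rewrite -sa -sb mark_id.
  move: u v => [] [] uv; [exact: arcs1 | by case: (notF uv) | | exact: arcs2].
  exact: congr1 eq_s.
have arcs_base s : first_bad n (markers s) (m - i.+1) a b ->
    state_arcs s = state_arcs (mark s i a b false true).
  move=> fbs; have fb0 := fb_mark s false true isT fbs.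
  have := arcs_mark _ (s (i, a)) (s (i, b)) fb0 (mark_left _ _ _ _ _ _)
    (mark_right _ _ _ _ neab) (bad s fbs).
  by rewrite mark_mark mark_id.
apply: (sum_mark_cancel neab) => [s|s u v|s].
- by move=> /andP[_ /asboolP fbs]; exact: bad.
- move=> /andP[eqC /asboolP fbs] uv; have fb_uv := fb_mark s u v uv fbs.
  have := arcs_base _ fb_uv; rewrite mark_mark => eq_arcs.
  apply/andP; split; last exact/asboolP.
  by rewrite eq_arcs; rewrite (arcs_base _ fbs) in eqC.
- move=> /andP[_ /asboolP fbs] sa sb.
  by have [_ _] := bad_cap_cancel fbs sa sb.
Qed.

Lemma catalan_coef_good (C : catalan_state m n) :
  catalan_coef C = \sum_(s : kauffman_state m n | (state_arcs s == C) &&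
    `[< forall u, (u < m)%N -> good n (markers s) u >]) Apow (writhe s).
Proof.
pose gd s := `[< forall u, (u < m)%N -> good n (markers s) u >].
pose fb (k : 'I_m * 'I_n * 'I_n) s :=
  `[< first_bad n (markers s) (m - k.1.1.+1) k.1.2 k.2 >].
have fb_bad k s : fb k s -> ~~ gd s.
  move=> /asboolP[_ Pab bad _]; apply/asboolP => /(_ _ _ _ _ Pab) good_ab.
  by apply: bad; apply: good_ab; have := ltn_ord k.1.1; lia.
have fb_uniq s k k' : fb k s -> fb k' s -> k = k'.
  case: k k' => [[i a] b] [[i' a'] b'] /asboolP fbs /asboolP fbs'.
  have /= [eqi /val_inj -> /val_inj ->] := first_bad_uniq fbs fbs'.
  congr (_, _, _); apply: val_inj => /=.
  by have := ltn_ord i; have := ltn_ord i'; lia.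
have ex_fb s : ~~ gd s -> exists k, fb k s.
  move=> /asboolP /exists_first_bad[t [a [b [ltm fbs]]]].
  have [_ Pab _ _] := fbs.
  have [/(_ _ _ Pab)[ltab ltbn _] _] := planar_cap n (markers s) t.
  have ltm' : (m - t.+1 < m)%N by lia.
  exists (Ordinal ltm', Ordinal (ltn_trans ltab ltbn), Ordinal ltbn).
  by apply/asboolP => /=; have -> : (m - (m - t.+1).+1)%N = t by lia.
transitivity (\sum_(s : kauffman_state m n | state_arcs s == C) state_weight s).
  by [].
rewrite (bigID gd) /= [X in _ + X](_ : _ = 0) ?addr0.
  apply: eq_bigr => s /andP[_ /asboolP /good_no_closed loops0].
  by rewrite /state_weight loops0 expr0 mulr1.
rewrite (partition_big (fun s => [pick k | fb k s]) xpredT) //= big1 // => o _.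
case: o => [[[i a] b]|]; last first.
  rewrite big_pred0 // => s; case: pickP => [k _|nofb]; first by rewrite andbF.
  apply/negP => /andP[/andP[_ /ex_fb[k fbk]] _].
  by rewrite nofb in fbk.
rewrite -[RHS](bad_states_cancel C i a b); apply: eq_bigl => s.
rewrite -andbA; congr (_ && _); rewrite -/(fb (i, a, b) s).
apply/andP/idP => [[_]|fbs]; first by case: pickP => // k fbk /eqP[<-].
split; first exact: fb_bad fbs.
by case: pickP => [k /fb_uniq/(_ fbs)->//|/(_ (i, a, b))]; rewrite fbs.
Qed.

End BadStates.

Local Open Scope ring_scope.

Theorem corollary3p10 (m n : nat) (C : catalan_state m n) (k : int) :
  0 <= (catalan_coef C)@_k.
Proof.
rewrite catalan_coef_good.
elim/big_ind: _ => [|f g f_ge0 g_ge0|s _]; first by rewrite mcoeff0.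
  by rewrite mcoeffD addr_ge0.
by rewrite mcoeffU; case: eqP.
Qed.
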